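(* Let $\Delta t>0$, $N\in\mathbb{N}$, $t_i=i\,\Delta t$, $U\subseteq\mathbb{R}^m$, $f:[0,T]\times\mathbb{R}^n\times U\to\mathbb{R}^n$, $\sigma:[0,T]\times\mathbb{R}^n\to\mathbb{R}^{n\times n}$, $\ell:[0,T]\times\mathbb{R}^n\times U\to\mathbb{R}_+$, $g:\mathbb{R}^n\to\mathbb{R}_+$, and a policy $\mu_i:\mathbb{R}^n\to U$. Under a measure $\widetilde{\mathsf{Q}}$ let $W_0^{\mathsf{Q}},\dots,W_{N-1}^{\mathsf{Q}}$ be mutually independent $\mathcal{N}(0,I_n)$ vectors, $X_0=x_0$, $X_{i+1}=X_i+F^\mu_i+\Sigma_iW^{\mathsf{Q}}_i$ with $F^\mu_i=f(t_i,X_i,\mu_i(X_i))\Delta t$, $\Sigma_i=\sigma(t_i,X_i)\sqrt{\Delta t}$, $L^\mu_j=\ell(t_j,X_j,\mu_j(X_j))\Delta t$, $V^\mu_i(X_i)=\mathbf{E}_{\widetilde{\mathsf{Q}}}[\sum_{j=i}^{N-1}L^\mu_j+g(X_N)\mid X_i]$, $Y_i=V^\mu_i(X_i)$. Fix $i$ and let $\widetilde V_{i+1}:\mathbb{R}^n\to\mathbb{R}$ be $C^2$; define $\overline X_{i+1}=X_i+F^\mu_i$, $\overline Y_{i+1}=\widetilde V_{i+1}(\overline X_{i+1})$, $\overline Z_{i+1}=\Sigma_i^\top\partial_x\widetilde V_{i+1}(\overline X_{i+1})$, $\overline M_{i+1}=\Sigma_i^\top\partial_{xx}\widetilde V_{i+1}(\overline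 X_{i+1})\Sigma_i$, $\widetilde Y_{i+1}=\overline Y_{i+1}+\overline Z_{i+1}^\top W^{\mathsf{Q}}_i+\tfrac12W^{\mathsf{Q}\top}_i\overline M_{i+1}W^{\mathsf{Q}}_i$, $\delta^{\mathrm{h.o.t.}}_{i+1}=\widetilde V_{i+1}(X_{i+1})-\widetilde Y_{i+1}$, $\delta^{\widetilde V}_{i+1}=V^\mu_{i+1}(X_{i+1})-\widetilde V_{i+1}(X_{i+1})$, and $$\Delta\widehat Y_i=-L^\mu_i+\overline Z_{i+1}^\top W^{\mathsf{Q}}_i+\tfrac12\operatorname{tr}\big(\overline M_{i+1}(W^{\mathsf{Q}}_iW^{\mathsf{Q}\top}_i-I)\big).$$ Define the two estimators $\widehat Y^{\mathrm{re\text{-}est}}_i:=\widetilde V_{i+1}(X_{i+1})-\Delta\widehat Y_i$ and $\widehat Y^{\mathrm{noiseless}}_i:=\widetilde Y_{i+1}-\Delta\widehat Y_i$. Then their biases are $$\mathbf{E}_{\widetilde{\mathsf{Q}}}[Y_i-\widehat Y^{\mathrm{re\text{-}est}}_i\mid X_i]=\mathbf{E}_{\widetilde{\mathsf{Q}}}[\delta^{\widetilde V}_{i+1}\mid X_i],\qquad \mathbf{E}_{\widetilde{\mathsf{Q}}}[Y_i-\widehat Y^{\mathrm{noiseless}}_i\mid X_i]=\mathbf{E}_{\widetilde{\mathsf{Q}}}[\delta^{\widetilde V}_{i+1}+\delta^{\mathrm{h.o.t.}}_{i+1}\mid X_i],$$ and their conditional variances are $$\operatorname{Var}_{\widetilde{\mathsf{Q}}}[\widehat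 Y^{\mathrm{re\text{-}est}}_i\mid X_i]=\operatorname{Var}_{\widetilde{\mathsf{Q}}}[\delta^{\mathrm{h.o.t.}}_{i+1}\mid X_i],\qquad \operatorname{Var}_{\widetilde{\mathsf{Q}}}[\widehat Y^{\mathrm{noiseless}}_i\mid X_i]=0.$$
   Context: $T=N\Delta t$; $\partial_x$, $\partial_{xx}$ denote gradient and Hessian. All random variables whose conditional expectations/variances appear are assumed square integrable. $W^{\mathsf{Q}}_i$ is independent of $X_i$. *)

(* Defs.v *)
From HB Require Import structures.
From mathcomp Require Import all_boot all_order all_algebra.
From mathcomp Require Import all_classical all_reals all_analysis.
Set Implicit Arguments. Unset Strict Implicit. Unset Printing Implicit Defensive.
Import Order.TTheory GRing.Theory Num.Theory.
Import numFieldNormedType.Exports.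
Local Open Scope classical_set_scope.
Local Open Scope ring_scope.

Section defs.
Variable R : realType.

Definition evec (n : nat) (k : 'I_n) : 'cV[R]_n := delta_mx k ord0.

Definition grad (n : nat) (V : 'cV[R]_n -> R) (x : 'cV[R]_n) : 'cV[R]_n :=
  \col_k 'D_(evec k) V x.
Definition hess (n : nat) (V : 'cV[R]_n -> R) (x : 'cV[R]_n) : 'M[R]_n :=
  \matrix_(k, l) 'D_(evec l) ('D_(evec k) V) x.

Definition C2 (n : nat) (V : 'cV[R]_n -> R) : Prop :=
  continuous V /\
  (forall k x, derivable V x (evec k)) /\
  (forall k, continuous ('D_(evec k) V)) /\
  (forall k l x, derivable ('D_(evec k) V) x (evec l)) /\
  (forall k l, continuous ('D_(evec l) ('D_(evec k) V))).

Definition borel_vec (n : nat) : set (set 'cV[R]_n) :=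
  <<s [set A | exists (k : 'I_n) (B : set R),
                 measurable B /\ A = (fun x : 'cV[R]_n => x k ord0) @^-1` B] >>.

Definition borel_fun (n : nat) (h : 'cV[R]_n -> R) : Prop :=
  forall B : set R, measurable B -> @borel_vec n (h @^-1` B).

Context d (T : measurableType d) (P : probability T R).

Definition sigmaX (n : nat) (X : T -> 'cV[R]_n) : set (set T) :=
  <<s [set A | exists (k : 'I_n) (B : set R),
                 measurable B /\ A = (fun w => X w k ord0) @^-1` B] >>.

Definition cexp_version (G : set (set T)) (Z Y : T -> R) : Prop :=
  (forall B : set R, measurable B -> G (Y @^-1` B)) /\
  P.-integrable setT (EFin \o Y) /\
  (forall A, G A -> (\int[P]_(w in A) (Y w)%:E = \int[P]_(w in A) (Z w)%:E)%E).

(** E_P[Z1 | G] = E_P[Z2 | G] (equality of a.s.-classes of versions) *)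
Definition cexp_eq (G : set (set T)) (Z1 Z2 : T -> R) : Prop :=
  forall Y, cexp_version G Z1 Y <-> cexp_version G Z2 Y.

Definition cvar_version (G : set (set T)) (Z v : T -> R) : Prop :=
  exists m, cexp_version G Z m /\ cexp_version G (fun w => (Z w - m w) ^+ 2) v.

Definition cvar_eq (G : set (set T)) (Z1 Z2 : T -> R) : Prop :=
  forall v, cvar_version G Z1 v <-> cvar_version G Z2 v.

Definition sq_integrable (Z : T -> R) : Prop :=
  measurable_fun setT Z /\ P.-integrable setT (fun w => (Z w ^+ 2)%:E).

Definition std_normal (Z : T -> R) : Prop :=
  measurable_fun setT Z /\
  forall B : set R, measurable B -> P (Z @^-1` B) = normal_prob 0 1 B.

Definition mutually_independent (I : finType) (Z : I -> T -> R) : Prop :=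
  forall (S : {set I}) (B : I -> set R), (forall s, measurable (B s)) ->
    P (\bigcap_(s in [set s | s \in S]) (Z s @^-1` B s)) =
    (\prod_(s in S) P (Z s @^-1` B s))%E.

End defs.

(* Main.v *)
Require Import Defs.
From HB Require Import structures.
From mathcomp Require Import all_boot all_order all_algebra.
From mathcomp Require Import all_classical all_reals all_analysis.
From mathcomp Require Import measurable_realfun.
From mathcomp Require Import ring lra.
Import Order.TTheory GRing.Theory Num.Theory.
Import numFieldNormedType.Exports.
Local Open Scope classical_set_scope.
Local Open Scope ring_scope.

Set Implicit Arguments. Unset Strict Implicit. Unset Printing Implicit Defensive.

(** Write [C = Ybar + L + tr M / 2], a function of [X_i], and
    [D = Z^T W + tr (M (W W^T - I)) / 2].  Since [W^T M W = tr (M W W^T)], one has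
    [DYhat = - L + D] and [Ytil = C + DYhat], so that the noiseless estimator is
    [C] and the re-estimate is [dhot + C]: this gives both conditional variances.
    The increment [W_i] is independent of the past and has moments 0 and [I], so
    [D] has zero mean on every event of the past, and both bias identities reduce
    to [E[V_i (X_i) - L_i - V_(i+1) (X_(i+1)) | X_i] = 0].  This is the tower
    property, except that [V_(i+1)] is defined by conditioning on [X_(i+1)] alone,
    a sigma-algebra that need not contain that of [X_i].  The Markov property of the
    Euler scheme repairs this: conditioning the future reward on the whole past
    gives the same result as conditioning on the present state. *)

(** * Sub-sigma-algebras and independence *)

Section sub_sigma_algebra.
Local Open Scope ereal_scope.
Context (R : realType) (d : measure_display) (T : measurableType d)
  (P : probability T R).

(* Measurability with respect to the sub-sigma-algebra [<<s G>>] is expressed as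
   measurability on [g_sigma_algebraType G], which has the same points as [T]. *)
Lemma measurable_fun_idG (G : set (set T)) : G `<=` measurable ->
  measurable_fun setT (idfun : T -> g_sigma_algebraType G).
Proof.
move=> Gm _ A mA; rewrite setTI.
exact: (smallest_sub (@sigma_algebra_measurable _ T) Gm).
Qed.

Lemma measurable_funG (G : set (set T)) d' (U : sigmaRingType d')
    (f : g_sigma_algebraType G -> U) : G `<=` measurable ->
  measurable_fun setT f -> measurable_fun setT (f : T -> U).
Proof.
by move=> Gm mf; exact: measurable_comp mf (measurable_fun_idG Gm).
Qed.

Definition restr_id (G : set (set T)) (Gm : G `<=` measurable) :
  {mfun T >-> g_sigma_algebraType G} :=
  mfun_Sub (mem_set (measurable_fun_idG Gm)).

(** This is [P] restricted to [<<s G>>], presented as the law of the identity map so that change of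
    variables under a pushforward applies to it. *)
Definition restr_prob (G : set (set T)) (Gm : G `<=` measurable) :
  probability (g_sigma_algebraType G) R := distribution P (restr_id Gm).

Lemma ge0_integral_restr_prob (G : set (set T)) (Gm : G `<=` measurable)
    (A : set T) (f : g_sigma_algebraType G -> \bar R) :
  <<s G >> A -> measurable_fun setT f ->
  (forall x, 0 <= f x) ->
  \int[restr_prob Gm]_(x in A) f x = \int[P]_(x in A) f x.
Proof.
move=> GA mf f0; rewrite ge0_integral_pushforward//.
exact: measurable_funTS.
Qed.

Lemma integral_restr_prob (G : set (set T)) (Gm : G `<=` measurable)
    (A : set T) (f : g_sigma_algebraType G -> \bar R) :
  <<s G >> A -> measurable_fun setT f ->
  P.-integrable setT f ->
  \int[restr_prob Gm]_(x in A) f x = \int[P]_(x in A) f x.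
Proof.
move=> GA mf intf; rewrite integral_pushforward//.
apply: integrableS intf => //.
exact: (smallest_sub (@sigma_algebra_measurable _ T) Gm).
Qed.

Definition indep (G H : set (set T)) :=
  forall A B, <<s G >> A -> <<s H >> B -> P (A `&` B) = P A * P B.

(** Both sides are finite measures in [A]: [P] restricted to [B], and [P] scaled by [P B]. Agreeing
    on a pi-system that contains the whole space, they agree on the sigma-algebra it generates. *)
Lemma indep_pi_systeml (G : set (set T)) (B : set T) : G `<=` measurable ->
  setI_closed G -> G setT -> measurable B ->
  (forall A, G A -> P (A `&` B) = P A * P B) ->
  forall A, <<s G >> A -> P (A `&` B) = P A * P B.
Proof.
move=> Gm GI GT mB GE.
have PB0 : (0 <= fine (P B))%R by exact: fine_ge0.
pose m1 : {measure set T -> \bar R} := mrestr P mB.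
pose m2 : {measure set T -> \bar R} := mscale (NngNum PB0) P.
have m2E A : m2 A = P A * P B.
  by rewrite /m2/= /mscale/= fineK ?fin_num_measure// muleC.
move=> A sA; rewrite -m2E.
apply: (@g_sigma_algebra_measure_unique _ _ _ _ Gm (fun _ => setT) _ _ m1 m2) => //.
- by rewrite bigcup_const.
- by move=> C GC; rewrite m2E; exact: GE.
- by move=> _; rewrite /m1/= /mrestr setTI ltey_eq fin_num_measure.
Qed.

(** The events are enlarged one side at a time: from [H] to [<<s H>>] with an event of [G] fixed,
    and from [G] to [<<s G>>] with an event of [<<s H>>] fixed. *)
Lemma pi_system_indep (G H : set (set T)) : G `<=` measurable ->
  H `<=` measurable -> setI_closed G -> setI_closed H -> G setT -> H setT ->
  (forall A B, G A -> H B -> P (A `&` B) = P A * P B) -> indep G H.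
Proof.
move=> Gm Hm GI HI GT HT GHE A B sA sB.
have mB : measurable B.
  exact: (smallest_sub (@sigma_algebra_measurable _ T) Hm).
apply: indep_pi_systeml sA => // C GC; rewrite setIC muleC.
apply: indep_pi_systeml sB => //; first exact: Gm.
by move=> D HD; rewrite setIC GHE// muleC.
Qed.

Section product.
Variables (G H : set (set T)) (Gm : G `<=` measurable) (Hm : H `<=` measurable).
Hypothesis GH : indep G H.

Let TG := g_sigma_algebraType G.
Let TH := g_sigma_algebraType H.

Let diag : T -> TG * TH := fun w => (w, w).

Let mdiag : measurable_fun setT diag.
Proof. by apply: measurable_fun_pair; exact: measurable_fun_idG. Qed.

Let diagM : {mfun T >-> (TG * TH)%type} := mfun_Sub (mem_set mdiag).

(** On rectangles this is independence itself; uniqueness of the product measure extends it to all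
    measurable sets. *)
Let diagE X : measurable X ->
  distribution P diagM X = (restr_prob Gm \x restr_prob Hm) X.
Proof.
by move=> mX; apply/esym; apply: product_measure_unique => // A B; exact: GH.
Qed.

(** Freezing: the sample point seen through [G] is held fixed while the one seen through [H] is
    averaged out. By [diagE] this is Tonelli's theorem for the image of [P] under the diagonal. *)
Lemma indep_ge0_integral (Phi : TG * TH -> \bar R) (A : set T) :
  measurable_fun setT Phi -> (forall x, 0 <= Phi x) -> <<s G >> A ->
  \int[P]_(w in A) Phi (w, w) = \int[P]_(w in A) \int[P]_v Phi (w, v).
Proof.
move=> mPhi Phi0 sA.
have mA : measurable (A : set TG) by [].
have mAT : measurable (A `*` setT : set (TG * TH)) by exact: measurableX.
(* The event constrains the [G] factor only, so it becomes a strip in the product. *)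
transitivity (\int[distribution P diagM]_(z in A `*` setT) Phi z).
  rewrite ge0_integral_pushforward//; last exact: measurable_funTS.
  by congr integral; apply/seteqP; split => x//= [].
rewrite (@eq_measure_integral _ _ _ _ (restr_prob Gm \x restr_prob Hm)); last first.
  by move=> X mX _; exact: diagE.
rewrite integral_mkcond fubini_tonelli1//; last 2 first.
- exact/(measurable_restrictT _ mAT)/measurable_funTS.
- by move=> z; rewrite patchE; case: ifP.
have mF : measurable_fun setT (fun w : TG => \int[restr_prob Hm]_v Phi (w, v)).
  exact: (@measurable_fun_fubini_tonelli_F _ _ _ _ _ (restr_prob Hm) Phi).
transitivity (\int[restr_prob Gm]_(w in A) \int[restr_prob Hm]_v Phi (w, v)).
  rewrite [RHS]integral_mkcond; apply: eq_integral => w _.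
  rewrite /fubini_F patchE; case: ifPn => wA.
    apply: eq_integral => v _; rewrite patchE ifT//.
    by rewrite inE; split => //; rewrite inE in wA.
  rewrite integral0_eq// => v _; rewrite patchE ifF//.
  by apply/negP; rewrite inE => -[/= Aw _]; move/negP: wA; rewrite inE.
rewrite ge0_integral_restr_prob//; last by move=> w; exact: integral_ge0.
apply: eq_integral => w _; rewrite ge0_integral_restr_prob//.
- exact: (@measurableT _ TH).
- exact: measurableT_comp mPhi (measurable_fun_pair _ _).
Qed.

Section mul.
Variables (X Y : T -> R).
Hypotheses (mX : measurable_fun setT (X : TG -> R))
  (mY : measurable_fun setT (Y : TH -> R)).
Hypotheses (iX : P.-integrable setT (EFin \o X))
  (iY : P.-integrable setT (EFin \o Y)).

Let XY (z : TG * TH) := (X z.1 * Y z.2)%:E.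

Let mXY : measurable_fun setT XY.
Proof.
apply/measurable_EFinP; apply: measurable_funM.
- exact: (measurableT_comp mX measurable_fst).
- exact: (measurableT_comp mY measurable_snd).
Qed.

Let integral_absXY :
  \int[P]_w `|XY (w, w)| = (\int[P]_w `|X w|%:E) * \int[P]_w `|Y w|%:E.
Proof.
have mTX : measurable_fun setT (X : T -> R) := measurable_funG Gm mX.
have mTY : measurable_fun setT (Y : T -> R) := measurable_funG Hm mY.
rewrite (@indep_ge0_integral (fun z => `|XY z|))//; last 2 first.
- exact: measurableT_comp.
- exact: (@measurableT _ TG).
transitivity (\int[P]_w (`|X w|%:E * \int[P]_w `|Y w|%:E)).
  apply: eq_integral => w _.
  rewrite -ge0_integralZl//.
  - by apply: eq_integral => v _; rewrite /= normrM.
  - by apply/measurable_EFinP; exact: measurableT_comp.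
rewrite ge0_integralZr//.
- by apply/measurable_EFinP; exact: measurableT_comp.
- exact: integral_ge0.
Qed.

(** Tonelli factors the absolute moment into a product of two finite ones. *)
Lemma indep_integrableM : P.-integrable setT (fun w => (X w * Y w)%:E).
Proof.
apply/integrableP; split.
  by apply/measurable_EFinP; apply: measurable_funM;
    [exact: measurable_funG Gm mX|exact: measurable_funG Hm mY].
rewrite (integral_absXY)//.
have /integrableP[_ fX] := iX; have /integrableP[_ fY] := iY.
by rewrite lte_mul_pinfty// ?integral_ge0// ge0_fin_numE// integral_ge0.
Qed.

(** Integrability of the product being settled, Fubini's theorem applies to the signed integrand on
    the product space. *)
Lemma indep_expectationM :
  \int[P]_w (X w * Y w)%:E = (\int[P]_w (X w)%:E) * \int[P]_w (Y w)%:E.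
Proof.
have mTX : measurable_fun setT (X : T -> R) := measurable_funG Gm mX.
have mTY : measurable_fun setT (Y : T -> R) := measurable_funG Hm mY.
have iXY : (restr_prob Gm \x restr_prob Hm).-integrable setT XY.
  apply/integrableP; split=> //.
  rewrite -(@eq_measure_integral _ _ _ _ _ (distribution P diagM)); last first.
    by move=> A mA _; exact: diagE.
  rewrite ge0_integral_pushforward//; last exact: measurableT_comp.
  by have /integrableP[] := indep_integrableM.
transitivity (\int[distribution P diagM]_z XY z).
  by rewrite integral_pushforward//; exact: indep_integrableM.
rewrite (@eq_measure_integral _ _ _ _ (restr_prob Gm \x restr_prob Hm)); last first.
  by move=> A mA _; exact: diagE.
rewrite -integral12_prod_meas1//.
have YE : \int[restr_prob Hm]_v (Y v)%:E = \int[P]_w (Y w)%:E.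
  by rewrite integral_restr_prob//;
    [exact: (@measurableT _ TH)|exact/measurable_EFinP].
have iYH : (restr_prob Hm).-integrable setT (EFin \o Y).
  apply: integrable_pushforward => //.
  exact/measurable_EFinP.
have fY : \int[P]_w (Y w)%:E \is a fin_num by exact: integrable_fin_num iY.
transitivity (\int[restr_prob Gm]_w ((X w)%:E * \int[P]_w (Y w)%:E)).
  by apply: eq_integral => w _; rewrite -YE -integralZl.
rewrite integral_restr_prob//; last 3 first.
- exact: (@measurableT _ TG).
- by apply: emeasurable_funM => //; exact/measurable_EFinP.
- by rewrite -(fineK fY); exact: (integrableZr measurableT (fine _) iX).
by rewrite -(fineK fY) integralZr.
Qed.

End mul.

(** The indicator of [A] is absorbed into [X], which remains integrable and measurable for
    [<<s G>>]. *)
Lemma indep_integralM (X Y : T -> R) (A : set T) :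
  measurable_fun setT (X : TG -> R) -> measurable_fun setT (Y : TH -> R) ->
  P.-integrable setT (EFin \o X) -> P.-integrable setT (EFin \o Y) ->
  <<s G >> A ->
  \int[P]_(w in A) (X w * Y w)%:E =
  (\int[P]_(w in A) (X w)%:E) * \int[P]_w (Y w)%:E.
Proof.
move=> mX mY iX iY sA.
have mA : measurable (A : set TG) by [].
have mTA : measurable A by exact: (smallest_sub (@sigma_algebra_measurable _ T) Gm).
transitivity (\int[P]_w ((X \_ A) w * Y w)%:E).
  rewrite integral_mkcond; apply: eq_integral => w _.
  by rewrite !patchE; case: ifP => // _; rewrite mul0r.
rewrite indep_expectationM//.
- congr (_ * _); rewrite [RHS]integral_mkcond; apply: eq_integral => w _.
  by rewrite !patchE; case: ifP.
- exact/(measurable_restrictT _ mA)/measurable_funTS.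
- rewrite (_ : EFin \o _ = (EFin \o X) \_ A).
    by apply/(integrable_mkcond _ mTA); exact: (integrableS measurableT mTA (@subsetT _ _) iX).
  by apply/funext => w; rewrite /= !patchE; case: ifP.
Qed.

End product.
End sub_sigma_algebra.

(** * Moments of the standard normal distribution *)

Section standard_normal_moments.
Context {R : realType}.
Local Notation mu := (@lebesgue_measure R).
Local Notation phi := (normal_pdf (0 : R) 1).

Let phiE x : phi x = (normal_peak (1 : R) * expR (- x ^+ 2 / 2))%R.
Proof.
by rewrite normal_pdfE ?oner_eq0// /normal_fun subr0 expr1n.
Qed.

Let phi_even x : phi (- x)%R = phi x.
Proof. by rewrite !phiE sqrrN. Qed.

Let phi_cvg0 : (phi x : R) @[x --> +oo%R] --> (0 : R).
Proof.
rewrite (_ : phi = (fun x => normal_peak 1 * expR (- (x ^+ 2 / 2)))%R); last first.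
  by apply/funext => x; rewrite phiE mulNr.
rewrite -[X in _ --> X](mulr0 (normal_peak 1)).
apply: cvgM; first exact: cvg_cst.
apply: (cvg_comp (fun x : R => (x ^+ 2 / 2)%R) (fun x => expR (- x)));
  last exact: cvgr_expR.
by apply/gt0_cvgMly; [rewrite invr_gt0|exact: cvgr_expr2].
Qed.

Let phi_is_derive (x : R) : is_derive x 1 (fun x => - phi x) (x * phi x).
Proof.
pose h (y : R) := (- 2^-1) *: y ^+ 2.
have -> : (fun x => - phi x) = (- normal_peak 1) *: (expR \o h).
  apply/funext => y.
  change (- phi y = - normal_peak 1 * expR (- 2^-1 * y ^+ 2)).
  by rewrite phiE [RHS]mulNr; congr (- (_ * expR _)); field.
have dh : is_derive x 1 h (- x).
  apply: is_derive_eq.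
  by rewrite /GRing.scale /= mulr1; field.
have dE := is_derive_expR (h x).
have dc : is_derive x 1 (expR \o h) (expR (h x) * - x) by exact: is_derive1_comp.
apply: is_derive_eq; rewrite phiE /h /GRing.scale /=.
rewrite (_ : - 2^-1 * x ^+ 2 = - x ^+ 2 / 2); first ring.
by field.
Qed.

(** The integrand has the primitive [- phi], which vanishes at [+oo]; starting from [0 <= y] keeps
    the integrand nonnegative. *)
Lemma integral_normal_pdf_tail (y : R) : 0 <= y ->
  (\int[mu]_(x in `[y, +oo[) (x * phi x)%:E = (phi y)%:E)%E.
Proof.
move=> y0.
rewrite (@ge0_continuous_FTC2y _ _ (fun x => - phi x)%R _ 0%R).
- by rewrite -EFinB sub0r opprK.
- by move=> x yx; rewrite mulr_ge0 ?normal_pdf_ge0// (le_trans y0).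
- apply: continuous_subspaceT => x; apply: cvgM; first exact: cvg_id.
  by apply: continuous_normal_pdf; rewrite oner_eq0.
- by rewrite -[X in _ --> X]oppr0; exact: cvgN phi_cvg0.
- by move=> x _; have [] := phi_is_derive x.
- apply: cvg_at_right_filter; apply: cvgN.
  by apply: continuous_normal_pdf; rewrite oner_eq0.
- by move=> x _; rewrite derive1E; exact: derive_val.
Qed.

(** The Radon-Nikodym derivative of [normal_prob] agrees with [phi] almost everywhere, because both
    have the same integral over every measurable set. *)
Lemma ge0_integral_normal_prob (f : R -> \bar R) :
  measurable_fun setT f -> (forall x, 0 <= f x)%E ->
  (\int[normal_prob (0 : R) 1]_x f x = \int[mu]_x (f x * (phi x)%:E))%E.
Proof.
move=> mf f0.
have dom := normal_prob_dominates (0 : R) 1.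
have mphi : measurable_fun setT (EFin \o phi).
  by apply/measurable_EFinP; exact: measurable_normal_pdf.
rewrite -(Radon_Nikodym_SigmaFinite.change_of_variables dom)//.
have mRN := measurable_int _ (Radon_Nikodym_SigmaFinite.f_integrable dom).
apply: ae_eq_integral => //; [exact: emeasurable_funM..|].
apply: ae_eqe_mul2l.
apply: integral_ae_eq => //; first exact: Radon_Nikodym_SigmaFinite.f_integrable.
by move=> E _ mE; rewrite -Radon_Nikodym_SigmaFinite.f_integral.
Qed.

Let symE (f : R -> \bar R) : measurable_fun setT f -> (forall x, 0 <= f x)%E ->
  (\int[mu]_x f (- x)%R = \int[mu]_x f x)%E.
Proof.
move=> mf f0.
have mN : measurable_fun setT (-%R : measurableTypeR R -> measurableTypeR R) by [].
rewrite -(ge0_integral_pushforward mN _ (D := setT))//.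
by apply: eq_measure_integral => A mA _; exact: lebesgue_measureN.
Qed.

(** By symmetry, the second moment and the total mass are twice their parts on the half line. There
    Tonelli turns the integral of [x * (x * phi x)] into that over [y] of the tail of [x * phi x]
    beyond [y], which is [phi y]; so the second moment equals the total mass. *)
Lemma integral_sqr_normal : (\int[normal_prob (0 : R) 1]_x (x ^+ 2)%:E = 1)%E.
Proof.
rewrite ge0_integral_normal_prob//; last 2 first.
- by apply/measurable_EFinP; exact: measurable_funX.
- by move=> x; rewrite lee_fin sqr_ge0.
under eq_integral do rewrite -EFinM.
have cphi : continuous phi by apply: continuous_normal_pdf; rewrite oner_eq0.
rewrite ge0_symfun_integralT; last 3 first.
- by move=> x; rewrite mulr_ge0 ?normal_pdf_ge0// sqr_ge0.
- by move=> x; apply: cvgM; [exact: exprn_continuous|exact: cphi].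
- by move=> x; rewrite /= phi_even sqrrN.
(* The right-hand side [1] is read as the total mass of [phi] and halved in the same way. *)
rewrite -(integral_normal_pdf (0 : R) 1) ge0_symfun_integralT//; last 2 first.
- by move=> x; exact: normal_pdf_ge0.
- by move=> x; rewrite /= phi_even.
congr (_ * _)%E.
have -> : [set x : R | (0 <= x)%R] = `[0%R, +oo[%classic by rewrite set_itvcy.
(* layer cake: [x ^ 2 * phi x] is the integral of [x * phi x] over [0 <= y <= x] *)
pose S : set (R * R) := [set z : R * R | 0 <= z.2 <= z.1].
have mS : measurable S.
  rewrite (_ : S = [set z : R * R | 0 <= z.2] `&` [set z : R * R | z.2 <= z.1]).
    apply: measurableI; rewrite -[X in measurable X]setTI;
      exact: (measurable_fun_le measurableT).
  by apply/seteqP; split => z /=; [move/andP|move=> ?; apply/andP].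
pose F := (fun z : R * R => (z.1 * phi z.1)%:E) \_ S.
have mF : measurable_fun setT F.
  apply/(measurable_restrictT _ mS)/measurable_funTS/measurable_EFinP.
  apply: measurable_funM => //.
  by apply: measurableT_comp => //; exact: measurable_normal_pdf.
have F0 z : (0 <= F z)%E.
  rewrite /F patchE; case: ifPn => // /[!inE] /andP[z0 z1].
  by rewrite lee_fin mulr_ge0 ?normal_pdf_ge0// (le_trans z0).
have FE (x y : R) : F (x, y) = if 0 <= y <= x then (x * phi x)%:E else 0%E.
  by rewrite /F patchE; congr (if _ then _ else _); apply/idP/idP; rewrite inE.
have muE (x : R) : 0 <= x -> mu `[0, x]%classic = x%:E.
  move=> x0; rewrite lebesgue_measure_itv /= lte_fin -EFinB subr0.
  by move: x0; rewrite le_eqVlt => /predU1P[<-|->//]; rewrite ltxx.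
transitivity (\int[mu]_x \int[mu]_y F (x, y))%E.
  rewrite integral_mkcond; apply: eq_integral => x _; rewrite patchE.
  case: ifPn => [|x0].
    rewrite inE /= in_itv /= andbT => x0.
    transitivity (\int[mu]_(y in `[0%R, x]) (x * phi x)%:E)%E.
      by rewrite integral_cst// [X in (_ * X)%E](muE _ x0) -EFinM expr2 mulrAC.
    rewrite integral_mkcond; apply: eq_integral => y _.
    by rewrite FE patchE; congr (if _ then _ else _); apply/idP/idP;
      rewrite inE /= in_itv.
  rewrite integral0_eq// => y _; rewrite FE ifF//.
  apply/negP => /andP[y0 yx].
  move: x0; rewrite notin_setE /= in_itv /= andbT; apply; exact: le_trans yx.
rewrite fubini_tonelli//.
rewrite [RHS]integral_mkcond; apply: eq_integral => y _; rewrite patchE.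
case: ifPn => [|y0].
  rewrite inE /= in_itv /= andbT => y0.
  rewrite -integral_normal_pdf_tail// [RHS]integral_mkcond.
  apply: eq_integral => x _.
  by rewrite FE patchE y0; congr (if _ then _ else _); apply/idP/idP;
    rewrite inE /= in_itv /= andbT.
rewrite integral0_eq// => x _; rewrite FE ifF//.
apply/negP => /andP[yy yx].
by move: y0; rewrite notin_setE /= in_itv /= andbT.
Qed.

Lemma integrable_sqr_normal :
  (normal_prob (0 : R) 1).-integrable setT (fun x : R => (x ^+ 2)%:E).
Proof.
apply/integrableP; split.
  by apply/measurable_EFinP; exact: measurable_funX.
under eq_integral do rewrite gee0_abs ?lee_fin ?sqr_ge0//.
by rewrite integral_sqr_normal ltry.
Qed.

(** The identity is dominated by [1 + x ^ 2], integrable since the second moment is finite. *)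
Lemma integrable_id_normal :
  (normal_prob (0 : R) 1).-integrable setT (EFin : R -> \bar R).
Proof.
apply: (@le_integrable _ _ _ (normal_prob (0 : R) 1) _ measurableT _
  (fun x : R => (1 + x ^+ 2)%:E)) => //.
- by move=> x _; rewrite lee_fin ler_norml [`|1 + _|]ger0_norm; nra.
- rewrite (_ : (fun _ => _) = (cst 1 \+ (fun x : R => (x ^+ 2)%:E))%E)//.
  apply: integrableD => //; last exact: integrable_sqr_normal.
  exact: finite_measure_integrable_cst.
Qed.

(** Reflection exchanges the positive and negative parts, so their integrals are equal; these are
    finite, so the difference is a genuine zero. *)
Lemma integral_id_normal : (\int[normal_prob (0 : R) 1]_x x%:E = 0)%E.
Proof.
pose f : R -> \bar R := EFin.
have mf : measurable_fun setT f by exact/measurable_EFinP.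
rewrite -/(integral _ _ f) integralE.
suff -> : (\int[normal_prob (0 : R) 1]_x f^\+ x =
           \int[normal_prob (0 : R) 1]_x f^\- x)%E.
  by rewrite subee// (integrable_neg_fin_num measurableT integrable_id_normal).
rewrite ge0_integral_normal_prob//; last exact: measurable_funepos.
rewrite ge0_integral_normal_prob//; last exact: measurable_funeneg.
rewrite -symE.
- apply: eq_integral => x _; rewrite phi_even; congr (_ * _)%E.
  by rewrite funeposE funenegE /f EFinN.
- apply: emeasurable_funM; first exact: measurable_funepos.
  by apply/measurable_EFinP; exact: measurable_normal_pdf.
- by move=> x; rewrite mule_ge0// lee_fin normal_pdf_ge0.
Qed.

End standard_normal_moments.

(** * Moments of a standard normal random variable *)

Section gaussian_variables.
Context (R : realType) (d : measure_display) (T : measurableType d)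
  (P : probability T R) (Z : T -> R).
Hypothesis hZ : std_normal P Z.

Let mZ : measurable_fun setT Z := hZ.1.
Let mZ' : measurable_fun setT (Z : T -> measurableTypeR R) := mZ.
Let ZM : {mfun T >-> measurableTypeR R} :=
  @mfun_Sub _ _ T (measurableTypeR R) _ (mem_set mZ').

Let ge0_integral_std_normal (f : R -> \bar R) :
  measurable_fun setT f -> (forall x, 0 <= f x)%E ->
  (\int[P]_w f (Z w) = \int[normal_prob (0 : R) 1]_x f x)%E.
Proof.
move=> mf f0.
rewrite -(@eq_measure_integral _ _ _ _ (normal_prob (0 : R) 1) (distribution P ZM)).
  by rewrite ge0_integral_pushforward.
by move=> A mA _; exact: hZ.2.
Qed.

Lemma std_normal_integrable_sqr : P.-integrable setT (fun w => (Z w ^+ 2)%:E).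
Proof.
apply/integrableP; split.
  by apply/measurable_EFinP; exact: measurable_funX.
rewrite (@ge0_integral_std_normal (fun x => `|(x ^+ 2)%:E|%E))//.
  by have /integrableP[] := @integrable_sqr_normal R.
by apply: measurableT_comp => //; apply/measurable_EFinP; exact: measurable_funX.
Qed.

Lemma std_normal_integral_sqr : (\int[P]_w (Z w ^+ 2)%:E = 1)%E.
Proof.
rewrite (@ge0_integral_std_normal (fun x => (x ^+ 2)%:E)).
- exact: integral_sqr_normal.
- by apply/measurable_EFinP; exact: measurable_funX.
- by move=> x; rewrite lee_fin sqr_ge0.
Qed.

Lemma std_normal_integrable : P.-integrable setT (EFin \o Z).
Proof.
apply/integrableP; split; first exact/measurable_EFinP.
rewrite (@ge0_integral_std_normal (fun x => `|x%:E|%E))//.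
  by have /integrableP[] := @integrable_id_normal R.
by apply: measurableT_comp => //; exact/measurable_EFinP.
Qed.

Lemma std_normal_integral : (\int[P]_w (Z w)%:E = 0)%E.
Proof.
rewrite -(@integral_id_normal R).
rewrite -(@eq_measure_integral _ _ _ _ (normal_prob (0 : R) 1) (distribution P ZM)).
  rewrite integral_pushforward//; first exact: std_normal_integrable.
by move=> A mA _; exact: hZ.2.
Qed.

End gaussian_variables.

(** * Cylinder events of a finite family of random variables *)

Section cylinders.
Context (R : realType) (d : measure_display) (T : measurableType d)
  (P : probability T R) (I : finType) (Z : I -> T -> R).

(** These finite rectangles generate the sigma-algebra of the variables indexed by [S]. They form a
    pi-system, and [mutually_independent] is stated on exactly such sets. *)
Definition cyl (S : {set I}) : set (set T) :=
  [set A | exists B : I -> set R, (forall s, measurable (B s)) /\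
     A = \bigcap_(s in [set s | s \in S]) (Z s @^-1` B s)].

Hypothesis mZ : forall s, measurable_fun setT (Z s).

Lemma cyl_measurable S : cyl S `<=` measurable.
Proof.
move=> _ [B [mB ->]]; apply: fin_bigcap_measurable.
  exact: finite_finset.
by move=> s _; rewrite -[X in measurable X]setTI; exact: mZ.
Qed.

Lemma cylT S : cyl S setT.
Proof.
exists (fun=> setT); split => //.
by apply/seteqP; split.
Qed.

Lemma cylI S : setI_closed (cyl S).
Proof.
move=> _ _ [B [mB ->]] [C [mC ->]].
exists (fun s => B s `&` C s); split; first by move=> s; exact: measurableI.
apply/seteqP; split => w.
  by move=> [wB wC] s sS; split; [exact: wB|exact: wC].
by move=> w_; split => s sS; have [] := w_ s sS.
Qed.

Lemma sub_cyl (S S' : {set I}) : S \subset S' -> <<s cyl S >> `<=` <<s cyl S' >>.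
Proof.
move=> /fintype.subsetP SS'; apply: sub_sigma_algebra2; move=> _ [B [mB ->]].
(* The additional indices carry no constraint. *)
exists (fun s => if s \in S then B s else setT); split.
  by move=> s; case: ifP.
apply/seteqP; split => w wB s.
  by move=> _ /=; case: ifPn => // sS; exact: wB.
by move=> /= sS; have := wB s (SS' _ sS); rewrite /= sS.
Qed.

Lemma measurable_fun_cyl (S : {set I}) s : s \in S ->
  measurable_fun setT (Z s : g_sigma_algebraType (cyl S) -> R).
Proof.
move=> sS _ B mB; rewrite setTI; apply: sub_sigma_algebra.
exists (fun s' => if s' == s then B else setT); split.
  by move=> s'; case: ifP.
apply/seteqP; split => w.
  by move=> wB s' _ /=; case: eqP => // ->.
by move=> /(_ s sS) /=; rewrite eqxx.
Qed.

(** The product over a disjoint union of index blocks splits into two block products. This settles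
    the cylinders, and the pi-system criterion does the rest. *)
Lemma cyl_indep (S S' : {set I}) : mutually_independent P Z ->
  fintype.disjoint (mem S) (mem S') -> indep P (cyl S) (cyl S').
Proof.
move=> Zind dSS'; apply: pi_system_indep; try exact: cyl_measurable;
  try exact: cylI; try exact: cylT.
move=> _ _ [B [mB ->]] [C [mC ->]].
rewrite !Zind//.
(* Disjointness makes [D] agree with [C] on all of [S'], so the two cylinders merge into one over
   the union. *)
pose D s := if s \in S then B s else C s.
have mD s : measurable (D s) by rewrite /D; case: ifP.
rewrite (_ : _ `&` _ = \bigcap_(s in [set s | s \in finset.setU S S']) (Z s @^-1` D s)).
  rewrite Zind// (eq_bigl [predU S & S']); last by move=> s; rewrite !inE.
  rewrite bigU//=; congr (_ * _)%E; apply: eq_bigr => s sS.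
    by rewrite /D sS.
  by rewrite /D (disjointFl dSS' sS).
apply/seteqP; split => w.
  move=> [wB wC] s; rewrite /= inE /D; case: ifPn => [sS _|_ /=]; first exact: wB.
  exact: wC.
move=> wD; split => s /= sS.
  by have := wD s; rewrite /= inE sS /D sS; exact.
by have := wD s; rewrite /= inE sS orbT /D (disjointFl dSS' sS); exact.
Qed.

End cylinders.

(** * Markov property *)

Section markov_chain.
Local Open Scope ereal_scope.
Context (R : realType) (d : measure_display) (T : measurableType d)
  (P : probability T R).
Context (dE : measure_display) (E : measurableType dE).
Variables (N : nat) (past noise : nat -> set (set T)).
Hypothesis pastm : forall j, past j `<=` measurable.
Hypothesis noisem : forall j, noise j `<=` measurable.
Hypothesis pastS : forall j, <<s past j >> `<=` <<s past j.+1 >>.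
Hypothesis past_noise : forall j, (j < N)%N -> indep P (past j) (noise j).
Variables (X : nat -> T -> E)
  (step : forall j, E * g_sigma_algebraType (noise j) -> E).
Hypothesis mX : forall j, (j <= N)%N ->
  measurable_fun setT (X j : g_sigma_algebraType (past j) -> E).
Hypothesis mstep : forall j, (j < N)%N -> measurable_fun setT (@step j).
Hypothesis XS : forall j, (j < N)%N -> forall w, X j.+1 w = @step j (X j w, w).

(** The state is determined by the past and the noise is independent of it, so the noise is
    integrated out with the state frozen: [phi] is the transition operator applied to [u]. The same
    [phi] serves every event of the past, not only those of [X j]. *)
Lemma markov_step j (u : E -> \bar R) : (j < N)%N ->
  measurable_fun setT u -> (forall x, 0 <= u x) ->
  exists phi : E -> \bar R, [/\ measurable_fun setT phi, forall x, 0 <= phi x &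
    forall A, <<s past j >> A ->
      \int[P]_(w in A) u (X j.+1 w) = \int[P]_(w in A) phi (X j w)].
Proof.
move=> jN mu u0.
have mF : measurable_fun setT (u \o @step j).
  by apply: measurableT_comp => //; exact: mstep.
exists (fubini_F (restr_prob P (@noisem j)) (u \o @step j)); split.
- by apply: (measurable_fun_fubini_tonelli_F (u \o @step j)) => // z; exact: u0.
- by move=> x; apply: integral_ge0 => w _; exact: u0.
- move=> A sA; under eq_integral do rewrite XS//.
  have mPhi : measurable_fun setT
      (fun z : g_sigma_algebraType (past j) * g_sigma_algebraType (noise j) =>
         u (@step j (X j z.1, z.2))).
    apply: (measurableT_comp mF); apply: measurable_fun_pair => //.
    by apply: (measurableT_comp (mX (ltnW jN))).
  rewrite (indep_ge0_integral (@pastm j) (@noisem j) (past_noise jN) mPhi)//.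
  apply: eq_integral => w _; rewrite /fubini_F ge0_integral_restr_prob//.
    exact: (@measurableT _ (g_sigma_algebraType (noise j))).
  by apply: (measurableT_comp mF); exact: measurable_fun_pair.
by move=> v; exact: u0.
Qed.

Variables (r : nat -> E -> R) (g : E -> R).
Hypothesis mr : forall k, measurable_fun setT (r k).
Hypothesis mg : measurable_fun setT g.
Hypothesis r0 : forall k x, (k < N)%N -> (0 <= r k x)%R.
Hypothesis g0 : forall x, (0 <= g x)%R.

Definition reward j w := (\sum_(j <= k < N) r k (X k w) + g (X N w))%R.

Let mXT j : (j <= N)%N -> measurable_fun setT (X j : T -> E).
Proof. by move=> jN; exact: (measurable_funG (@pastm j) (mX jN)). Qed.

Lemma reward_ge0 j w : (0 <= reward j w)%R.
Proof.
rewrite /reward; apply: addr_ge0; last exact: g0.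
rewrite big_nat; apply: sumr_ge0 => k /andP[_ kN].
exact: r0.
Qed.

Lemma measurable_reward j : measurable_fun setT (reward j).
Proof.
apply: measurable_funD; last exact: measurableT_comp mg (mXT _).
(* The test [k < N] carries the range of summation into each summand, since [X k] is only known to
   be measurable up to time [N]. *)
rewrite [X in measurable_fun _ X](_ : _ = fun w =>
    \sum_(j <= k < N) if (k < N)%N then r k (X k w) else 0)%R; last first.
  by apply/funext => w; apply: eq_big_nat => k /andP[_ ->].
apply: measurable_sum => k; case: (ltnP k N) => kN; last exact: measurable_cst.
exact: measurableT_comp (mr k) (mXT (ltnW kN)).
Qed.

(** Backward induction, on the number [N - j] of remaining steps. All terms are nonnegative, so no
    integrability is involved. *)
Lemma markov_reward j : (j <= N)%N ->
  exists phi : E -> \bar R, [/\ measurable_fun setT phi, forall x, 0 <= phi x &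
    forall A, <<s past j >> A ->
      \int[P]_(w in A) (reward j w)%:E = \int[P]_(w in A) phi (X j w)].
Proof.
move: {2}(N - j)%N (erefl (N - j)%N) => m; elim: m j => [|m IH] j mE jN.
  have {jN mE}-> : j = N by apply/eqP; rewrite eqn_leq jN -subn_eq0 mE.
  exists (EFin \o g); split.
  - exact/measurable_EFinP.
  - by move=> x; rewrite lee_fin.
  - move=> A _; apply: eq_integral => w _.
    by rewrite /reward big_geq// add0r.
have {}jN : (j < N)%N by rewrite -subn_gt0 mE.
have [|psi [mpsi psi0 psiE]] := IH j.+1 _ jN; first by rewrite subnS mE.
have [phi [mphi phi0 phiE]] := markov_step jN mpsi psi0.
(* Dynamic programming: the present reward plus the transition operator applied to the later value
   [psi]. *)
exists (fun x => (r j x)%:E + phi x); split.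
- by apply: emeasurable_funD => //; exact/measurable_EFinP.
- by move=> x; rewrite adde_ge0// lee_fin r0.
- move=> A sA.
  have mA : measurable A.
    exact: (smallest_sub (@sigma_algebra_measurable _ T) (@pastm j)).
  have mrX : measurable_fun A (fun w => (r j (X j w))%:E).
    apply/measurable_EFinP/measurable_funTS.
    exact: measurableT_comp (mr j) (mXT (ltnW jN)).
  transitivity (\int[P]_(w in A) ((r j (X j w))%:E + (reward j.+1 w)%:E)).
    by apply: eq_integral => w _; rewrite -EFinD /reward big_ltn// addrA.
  rewrite ge0_integralD//.
  + rewrite ge0_integralD//.
    (* [A] belongs to the past of [j], whereas [psiE] speaks of the past of [j.+1]. *)
    * by rewrite psiE ?phiE//; exact: pastS.
    * by move=> w _; rewrite lee_fin r0.
    * by apply/measurable_funTS; exact: measurableT_comp mphi (mXT (ltnW jN)).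
  + by move=> w _; rewrite lee_fin r0.
  + by move=> w _; rewrite lee_fin reward_ge0.
  + by apply/measurable_EFinP/measurable_funTS; exact: measurable_reward.
Qed.

(* The version [phi (X j)] given by [markov_reward] is valid on the whole past, and
   it is equal to [v] almost everywhere because both are [G]-measurable. *)
Lemma markov_value j (G : set (set T)) (v : T -> R) : (j <= N)%N ->
  <<s G >> `<=` <<s past j >> ->
  measurable_fun setT (X j : g_sigma_algebraType G -> E) ->
  cexp_version P <<s G >> (reward j) v ->
  forall A, <<s past j >> A ->
    \int[P]_(w in A) (v w)%:E = \int[P]_(w in A) (reward j w)%:E.
Proof.
move=> jN Gpast mXG [mv [iv vE]] A sA.
have sm := smallest_sub (@sigma_algebra_measurable _ T) (@pastm j).
have Gm : G `<=` measurable.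
  move=> B GB; apply: sm; apply: Gpast; exact: sub_sigma_algebra.
have [phi [mphi phi0 phiE]] := markov_reward jN.
have mvG : measurable_fun setT (EFin \o v : g_sigma_algebraType G -> \bar R).
  by apply/measurable_EFinP => _ B mB; rewrite setTI; exact: mv.
have mphiX : measurable_fun setT (phi \o X j : g_sigma_algebraType G -> \bar R).
  exact: measurableT_comp.
have ivG : (restr_prob P Gm).-integrable setT (EFin \o v).
  exact: integrable_pushforward.
(* Under [restr_prob] the test sets are precisely the events of [<<s G>>], the only ones on which
   [v] is known to have the right integrals. *)
have : ae_eq (restr_prob P Gm) setT (EFin \o v) (phi \o X j).
  apply: integral_ae_eq => // B _ sB.
  rewrite integral_restr_prob// vE// ge0_integral_restr_prob//.
    by rewrite phiE//; exact: Gpast.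
  by move=> w; exact: phi0.
case=> B [mB PB0 vB].
rewrite phiE//; apply: ae_eq_integral => //; first exact: sm.
- by apply/measurable_funTS; exact: measurable_int iv.
- by apply/measurable_funTS; exact: measurableT_comp mphi (mXT jN).
exists B; split => //; first by apply: sm; exact: Gpast.
by move=> w nw; apply: vB => h; apply: nw => _; exact: h.
Qed.

End markov_chain.

(** * Conditional expectation *)

Section conditional_expectation.
Context (R : realType) (d : measure_display) (T : measurableType d)
  (P : probability T R).
Implicit Types (X Y Z : T -> R).

(** The bound [1 + Z ^ 2] dominates [Z], and constants are integrable under a probability. *)
Lemma sq_integrable_integrable Z : sq_integrable P Z ->
  P.-integrable setT (EFin \o Z).
Proof.
move=> [mZ iZ].
apply: (@le_integrable _ _ _ P _ measurableT _ (fun w => (1 + Z w ^+ 2)%:E)) => //.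
- exact/measurable_EFinP.
- by move=> w _; rewrite lee_fin ler_norml [`|1 + _|]ger0_norm; nra.
- rewrite (_ : (fun _ => _) = (cst 1 \+ (fun w => (Z w ^+ 2)%:E))%E)//.
  apply: integrableD => //.
  exact: finite_measure_integrable_cst.
Qed.

Lemma integrableRD X Y : P.-integrable setT (EFin \o X) ->
  P.-integrable setT (EFin \o Y) -> P.-integrable setT (EFin \o (fun w => X w + Y w)).
Proof. exact: integrableD. Qed.

Lemma integrableRB X Y : P.-integrable setT (EFin \o X) ->
  P.-integrable setT (EFin \o Y) -> P.-integrable setT (EFin \o (fun w => X w - Y w)).
Proof. exact: integrableB. Qed.

Lemma integrableRZ (c : R) X : P.-integrable setT (EFin \o X) ->
  P.-integrable setT (EFin \o (fun w => c * X w)).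
Proof. exact: integrableZl. Qed.

Lemma integrableR_sum (I : finType) (F : I -> T -> R) :
  (forall i, P.-integrable setT (EFin \o F i)) ->
  P.-integrable setT (EFin \o (fun w => \sum_i F i w)).
Proof.
move=> iF.
rewrite (_ : EFin \o _ = fun w => (\sum_(i <- index_enum I) (EFin \o F i) w)%E); last first.
  by apply/funext => w /=; rewrite sumEFin.
exact: integrable_sum.
Qed.

(** Equivalently, zero is a version of the conditional expectation of the integrable variable [Y]
    given [<<s G>>]. *)
Definition centered (G : set (set T)) Y :=
  P.-integrable setT (EFin \o Y) /\
  forall A, <<s G >> A -> (\int[P]_(w in A) (Y w)%:E = 0)%E.

Lemma sub_centered (G H : set (set T)) Y :
  <<s G >> `<=` <<s H >> -> centered H Y -> centered G Y.
Proof. by move=> GH [iY Y0]; split => // A /GH; exact: Y0. Qed.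

Section sub_algebra.
Variable G : set (set T).
Hypothesis Gm : G `<=` measurable.

Let sm : <<s G >> `<=` measurable.
Proof. exact: (smallest_sub (@sigma_algebra_measurable _ T) Gm). Qed.

Let iS X A : P.-integrable setT (EFin \o X) -> <<s G >> A ->
  P.-integrable A (EFin \o X).
Proof. by move=> iX /sm mA; exact: (integrableS measurableT mA (@subsetT _ _) iX). Qed.

Lemma centeredD X Y : centered G X -> centered G Y ->
  centered G (fun w => X w + Y w).
Proof.
move=> [iX X0] [iY Y0]; split; first exact: integrableRD.
move=> A sA; have mA := sm sA.
by rewrite (integralD mA (iS iX sA) (iS iY sA)) X0// Y0// adde0.
Qed.

Lemma centeredZ (c : R) X : centered G X -> centered G (fun w => c * X w).
Proof.
move=> [iX X0]; split; first exact: integrableRZ.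
by move=> A sA; rewrite (integralZl (sm sA) (iS iX sA)) X0// mule0.
Qed.

Lemma centered_sum (I : finType) (F : I -> T -> R) :
  (forall i, centered G (F i)) -> centered G (fun w => \sum_i F i w).
Proof.
move=> cF; split; first by apply: integrableR_sum => i; have [] := cF i.
move=> A sA; have mA := sm sA.
under eq_integral do rewrite -sumEFin.
rewrite integral_sum//.
- by apply: big1 => i _; have [_ ->] := cF i.
- by move=> i; apply: (iS _ sA); have [] := cF i.
Qed.

(** Conditionally on [G], the factor [X] is known and [Y] averages to its mean, zero. *)
Lemma indep_centeredM (H : set (set T)) X Y : H `<=` measurable -> indep P G H ->
  measurable_fun setT (X : g_sigma_algebraType G -> R) ->
  measurable_fun setT (Y : g_sigma_algebraType H -> R) ->
  P.-integrable setT (EFin \o X) -> P.-integrable setT (EFin \o Y) ->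
  (\int[P]_w (Y w)%:E = 0)%E -> centered G (fun w => X w * Y w).
Proof.
move=> Hm GH mX mY iX iY Y0; split; first exact: (indep_integrableM Gm Hm GH mX mY).
by move=> A sA; rewrite (indep_integralM Gm Hm GH mX mY)// Y0 mule0.
Qed.

(** Versions depend on a variable only through its integrals over events of [<<s G>>], and these
    coincide for [Z1] and [Z2]. *)
Lemma cexp_eq_centered Z1 Z2 : P.-integrable setT (EFin \o Z2) ->
  centered G (fun w => Z1 w - Z2 w) -> cexp_eq P <<s G >> Z1 Z2.
Proof.
move=> iZ2 [iZ Z0].
have ZE A : <<s G >> A ->
    (\int[P]_(w in A) (Z1 w)%:E = \int[P]_(w in A) (Z2 w)%:E)%E.
  move=> sA; have mA := sm sA.
  transitivity (\int[P]_(w in A) ((Z2 w)%:E + (Z1 w - Z2 w)%:E))%E.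
    by apply: eq_integral => w _; rewrite -EFinD addrC subrK.
  by rewrite (integralD mA (iS iZ2 sA) (iS iZ sA)) Z0// adde0.
by move=> Y; split => -[mY [iY YE]]; split => //; split => // A sA; rewrite YE// ZE.
Qed.

Let mP (C : T -> R) : measurable_fun setT (C : g_sigma_algebraType G -> R) <->
  (forall B, measurable B -> <<s G >> (C @^-1` B)).
Proof.
split=> [mC B mB|mC _ B mB]; last by rewrite setTI; exact: mC.
by rewrite -[X in <<s G >> X]setTI; exact: mC.
Qed.

Lemma cexp_versionB Z C Y : P.-integrable setT (EFin \o Z) ->
  P.-integrable setT (EFin \o C) ->
  measurable_fun setT (C : g_sigma_algebraType G -> R) ->
  cexp_version P <<s G >> Z Y ->
  cexp_version P <<s G >> (fun w => Z w - C w) (fun w => Y w - C w).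
Proof.
move=> iZ iC mC [/mP mY [iY YE]]; split; [|split].
- by apply/mP; exact: measurable_funB.
- exact: integrableRB.
- move=> A sA; have mA := sm sA.
  under eq_integral do rewrite EFinB.
  under [RHS]eq_integral do rewrite EFinB.
  by rewrite !integralB//; [rewrite YE|exact: iS..].
Qed.

(** A known shift moves the conditional mean by the same amount, so the deviation from it is
    unchanged. *)
Let cvarB Z C v : P.-integrable setT (EFin \o Z) ->
  P.-integrable setT (EFin \o C) ->
  measurable_fun setT (C : g_sigma_algebraType G -> R) ->
  cvar_version P <<s G >> Z v ->
  cvar_version P <<s G >> (fun w => Z w - C w) v.
Proof.
move=> iZ iC mC [m [mE vE]]; exists (fun w => m w - C w); split.
  exact: cexp_versionB.
rewrite (_ : (fun w => _) = fun w => (Z w - m w) ^+ 2)//.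
by apply/funext => w; congr (_ ^+ 2); ring.
Qed.

Lemma cvar_eqB Z C : P.-integrable setT (EFin \o Z) ->
  P.-integrable setT (EFin \o C) ->
  measurable_fun setT (C : g_sigma_algebraType G -> R) ->
  cvar_eq P <<s G >> Z (fun w => Z w - C w).
Proof.
move=> iZ iC mC v; split; first exact: cvarB.
have iNC : P.-integrable setT (EFin \o (fun w => - C w)).
  exact: integrableN iC.
have mNC : measurable_fun setT ((fun w => - C w) : g_sigma_algebraType G -> R).
  exact: measurableT_comp.
move=> /(cvarB (integrableRB iZ iC) iNC mNC).
rewrite (_ : (fun w => _ - _ - _) = Z)//.
by apply/funext => w; rewrite opprK subrK.
Qed.

(** A variable measurable for [<<s G>>] is its own conditional mean, so its deviation vanishes
    identically. *)
Lemma cvar_version_self C : P.-integrable setT (EFin \o C) ->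
  measurable_fun setT (C : g_sigma_algebraType G -> R) ->
  cvar_version P <<s G >> C (fun=> 0).
Proof.
move=> iC mC; exists C; split; first by split; [exact/mP|split].
split; [|split].
- by apply/mP; exact: measurable_cst.
- exact: integrable0.
- by move=> A _; apply: eq_integral => w _; rewrite subrr expr0n.
Qed.

End sub_algebra.
End conditional_expectation.

(** * Gaussian increments and the Euler scheme *)

Section borel_vectors.
Context (R : realType) (n : nat).

(** The generators inside [borel_vec] are named so that vectors can carry the generated
    sigma-algebra as a measurable type. *)
Definition coord_gens : set (set 'cV[R]_n) :=
  [set A | exists (k : 'I_n) (B : set R),
     measurable B /\ A = (fun x : 'cV[R]_n => x k ord0) @^-1` B].

Definition borelV := g_sigma_algebraType coord_gens.

Lemma borel_funP (h : 'cV[R]_n -> R) :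
  borel_fun h <-> measurable_fun setT (h : borelV -> R).
Proof.
split=> [mh _ B mB|mh B mB]; first by rewrite setTI; exact: mh.
by rewrite -[X in borel_vec X]setTI; exact: mh.
Qed.

Lemma measurable_coord (k : 'I_n) :
  measurable_fun setT ((fun x => x k ord0) : borelV -> R).
Proof.
by move=> _ B mB; rewrite setTI; apply: sub_sigma_algebra; exists k, B.
Qed.

Lemma measurable_fun_borelV d (U : measurableType d) (f : U -> borelV) :
  (forall k : 'I_n, measurable_fun setT (fun u => (f u : 'cV[R]_n) k ord0)) ->
  measurable_fun setT f.
Proof.
move=> mf; apply: (@measurability _ _ _ borelV _ _ coord_gens) => //.
move=> _ [_ [k [B [mB ->]] <-]].
exact: mf.
Qed.

(** These are the generators of [sigmaX X], which is thus [<<s state_gens X>>] by unfolding. *)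
Definition state_gens (T : Type) (X : T -> 'cV[R]_n) : set (set T) :=
  [set A | exists (k : 'I_n) (B : set R),
     measurable B /\ A = (fun w => X w k ord0) @^-1` B].

Lemma measurable_state_gens d (T : measurableType d) (X : T -> 'cV[R]_n) :
  measurable_fun setT (X : g_sigma_algebraType (state_gens X) -> borelV).
Proof.
apply: measurable_fun_borelV => k _ B mB.
by rewrite setTI; apply: sub_sigma_algebra; exists k, B.
Qed.

Lemma sub_state_gens d (T : measurableType d) (G : set (set T)) (X : T -> 'cV[R]_n) :
  measurable_fun setT (X : g_sigma_algebraType G -> borelV) ->
  <<s state_gens X >> `<=` <<s G >>.
Proof.
move=> mX; apply: smallest_sub; first exact: smallest_sigma_algebra.
move=> _ [k [B [mB ->]]].
have := measurableT_comp (measurable_coord k) mX.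
by move=> /(_ measurableT _ mB); rewrite setTI.
Qed.

End borel_vectors.

Section gaussian_increments.
Context (R : realType) (d : measure_display) (T : measurableType d)
  (P : probability T R) (n N : nat) (W : nat -> 'I_n -> T -> R).
Hypothesis hW : forall (j : 'I_N) (k : 'I_n), std_normal P (W j k).
Hypothesis hWind : mutually_independent P (fun p : 'I_N * 'I_n => W p.1 p.2).

Let Z (p : 'I_N * 'I_n) := W p.1 p.2.
Let mZ p : measurable_fun setT (Z p) := (hW p.1 p.2).1.

(** The inequality is strict because the state at time [j] involves the increments up to [j - 1]
    only. At [j = 0] the block is empty, which suits a deterministic initial state. *)
Definition past (j : nat) : set (set T) :=
  cyl Z (finset.finset (fun p : 'I_N * 'I_n => (p.1 < j)%N)).
Definition noise (j : nat) : set (set T) :=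
  cyl Z (finset.finset (fun p : 'I_N * 'I_n => p.1 == j :> nat)).

Lemma past_measurable j : past j `<=` measurable.
Proof. exact: cyl_measurable. Qed.

Lemma noise_measurable j : noise j `<=` measurable.
Proof. exact: cyl_measurable. Qed.

Lemma pastS j : <<s past j >> `<=` <<s past j.+1 >>.
Proof.
by apply: sub_cyl; apply/fintype.subsetP => p; rewrite !inE => /ltnW.
Qed.

Lemma noise_pastS j : <<s noise j >> `<=` <<s past j.+1 >>.
Proof.
by apply: sub_cyl; apply/fintype.subsetP => p; rewrite !inE => /eqP ->.
Qed.

Lemma past_noise_indep j : indep P (past j) (noise j).
Proof.
apply: cyl_indep => //; apply/pred0P => p /=; rewrite !inE.
by case: ltngtP.
Qed.

Lemma measurable_noise j k : (j < N)%N ->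
  measurable_fun setT (W j k : g_sigma_algebraType (noise j) -> R).
Proof.
move=> jN.
by apply: (@measurable_fun_cyl _ _ _ _ Z _ (Ordinal jN, k)); rewrite inE.
Qed.

Lemma measurable_fun_sub_gens d' (U : measurableType d') (G H : set (set T))
    (f : T -> U) : <<s G >> `<=` <<s H >> ->
  measurable_fun setT (f : g_sigma_algebraType G -> U) ->
  measurable_fun setT (f : g_sigma_algebraType H -> U).
Proof. by move=> GH mf _ B mB; apply: GH; exact: mf. Qed.

(** On the diagonal this is the second moment. Off the diagonal, the two components are independent
    as cylinders over distinct singletons, and the means vanish. *)
Lemma std_normal_integralM (i : nat) (k l : 'I_n) : (i < N)%N ->
  P.-integrable setT (fun w => (W i k w * W i l w)%:E) /\
  (\int[P]_w (W i k w * W i l w)%:E = ((k == l)%:R)%:E)%E.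
Proof.
move=> iN; pose i' := Ordinal iN.
have [<-|kl] := eqVneq k l.
  split; first exact: (std_normal_integrable_sqr (hW i' k)).
  exact: (std_normal_integral_sqr (hW i' k)).
have cind : indep P (cyl Z (finset.set1 (i', k))) (cyl Z (finset.set1 (i', l))).
  apply: cyl_indep => //; apply/pred0P => p /=; rewrite !inE.
  by apply/negP => /andP[/eqP -> /eqP [/eqP]]; apply/negP.
have mW k' : measurable_fun setT
    (W i k' : g_sigma_algebraType (cyl Z (finset.set1 (i', k'))) -> R).
  by apply: (@measurable_fun_cyl _ _ _ _ Z _ (i', k')); rewrite inE.
have cm S : cyl Z S `<=` measurable by exact: cyl_measurable.
have iW k' := std_normal_integrable (hW i' k').
split; first exact: (indep_integrableM (cm _) (cm _) cind (mW k) (mW l) (iW k) (iW l)).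
rewrite (indep_expectationM (cm _) (cm _) cind (mW k) (mW l) (iW k) (iW l)).
by rewrite (std_normal_integral (hW i' k)) mul0e.
Qed.

Section increments.
Variables (i : nat) (iN : (i < N)%N).

Lemma centered_linear (z : T -> 'cV[R]_n) :
  (forall k, measurable_fun setT
     ((fun w => z w k ord0) : g_sigma_algebraType (past i) -> R)) ->
  (forall k, P.-integrable setT (EFin \o (fun w => z w k ord0))) ->
  centered P (past i) (fun w => ((z w)^T *m \col_k W i k w) ord0 ord0).
Proof.
move=> mz iz.
rewrite (_ : (fun w => _) = fun w => \sum_k z w k ord0 * W i k w); last first.
  by apply/funext => w; rewrite mxE; apply: eq_bigr => k _; rewrite !mxE.
apply: centered_sum; first exact: past_measurable.
move=> k; apply: (indep_centeredM (@past_measurable i) (@noise_measurable i)) => //.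
- exact: past_noise_indep.
- exact: measurable_noise.
- exact: (std_normal_integrable (hW (Ordinal iN) k)).
- exact: (std_normal_integral (hW (Ordinal iN) k)).
Qed.

(** Entrywise, a coefficient known from the past multiplies [W_l W_k - delta_lk], a function of the
    present noise with mean zero. *)
Lemma centered_quadratic (M : T -> 'M[R]_n) :
  (forall k l, measurable_fun setT
     ((fun w => M w k l) : g_sigma_algebraType (past i) -> R)) ->
  (forall k l, P.-integrable setT (EFin \o (fun w => M w k l))) ->
  centered P (past i) (fun w =>
    \tr (M w *m ((\col_k W i k w) *m (\col_k W i k w)^T - 1%:M))).
Proof.
move=> mM iM.
rewrite (_ : (fun w => _) = fun w =>
    \sum_k \sum_l M w k l * (W i l w * W i k w - (l == k)%:R)); last first.
  apply/funext => w; apply: eq_bigr => k _; rewrite mxE.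
  by apply: eq_bigr => l _; rewrite !mxE big_ord1 !mxE.
apply: centered_sum; first exact: past_measurable.
move=> k; apply: centered_sum; first exact: past_measurable.
move=> l; have [iWW WWE] := std_normal_integralM l k iN.
have ic : P.-integrable setT (EFin \o (fun=> (l == k)%:R : R)).
  exact: finite_measure_integrable_cst.
apply: (indep_centeredM (@past_measurable i) (@noise_measurable i)) => //.
- exact: past_noise_indep.
- by apply: measurable_funB => //; apply: measurable_funM; exact: measurable_noise.
- exact: (integrableRB iWW ic).
- under eq_integral do rewrite EFinB.
  by rewrite integralB// WWE integral_cst//
    [X in (_ - _ * X)%E](probability_setT P) mule1 -EFinB subrr.
Qed.

End increments.

Section euler_scheme.
Variables (b : nat -> 'cV[R]_n -> 'cV[R]_n) (s : nat -> 'cV[R]_n -> 'M[R]_n).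
Hypothesis mb : forall j k, borel_fun (fun x => b j x k ord0).
Hypothesis ms : forall j k k', borel_fun (fun x => s j x k k').
Variables (x0 : 'cV[R]_n) (X : nat -> T -> 'cV[R]_n).
Hypothesis X0 : X 0%N = fun=> x0.
Hypothesis XS : forall j, (j < N)%N -> forall w,
  X j.+1 w = X j w + b j (X j w) + s j (X j w) *m (\col_k W j k w).

(** The second argument is the sample point itself, seen through the noise sigma-algebra: this is
    the shape of [step] in the Markov property. *)
Definition euler_step j (z : borelV R n * g_sigma_algebraType (noise j)) : borelV R n :=
  (z.1 : 'cV[R]_n) + b j z.1 + s j z.1 *m (\col_k W j k z.2).

Lemma measurable_euler_step j : (j < N)%N -> measurable_fun setT (@euler_step j).
Proof.
move=> jN; apply: measurable_fun_borelV => k.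
rewrite (_ : (fun u => _) = fun u : borelV R n * g_sigma_algebraType (noise j) =>
    (u.1 : 'cV[R]_n) k ord0 + b j u.1 k ord0 + \sum_l s j u.1 k l * W j l u.2); last first.
  apply/funext => u; rewrite /euler_step !mxE; congr (_ + _).
  by apply: eq_bigr => l _; rewrite mxE.
apply: measurable_funD.
  apply: measurable_funD.
    exact: (measurableT_comp (measurable_coord k) measurable_fst).
  exact: (measurableT_comp ((borel_funP _).1 (mb j k)) measurable_fst).
apply: measurable_sum => l; apply: measurable_funM.
  exact: (measurableT_comp ((borel_funP _).1 (ms j k l)) measurable_fst).
exact: (measurableT_comp (measurable_noise l jN) measurable_snd).
Qed.

Lemma measurable_state j : (j <= N)%N ->
  measurable_fun setT (X j : g_sigma_algebraType (past j) -> borelV R n).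
Proof.
elim: j => [_|j IH jN]; first by rewrite X0; exact: measurable_cst.
rewrite (_ : X j.+1 = fun w => @euler_step j (X j w, w)); last first.
  by apply/funext => w; rewrite XS.
apply: (measurableT_comp (measurable_euler_step jN)).
apply: measurable_fun_pair.
  by apply: (measurable_fun_sub_gens (@pastS j)); exact: IH (ltnW jN).
by move=> _ B mB; rewrite setTI; exact: noise_pastS.
Qed.

End euler_scheme.
End gaussian_increments.

(** * The bias and variance identities *)

Lemma quadratic_trace (R : comNzRingType) (n : nat) (M : 'M[R]_n) (v : 'cV[R]_n) :
  (v^T *m M *m v) ord0 ord0 = \tr (M *m (v *m v^T)).
Proof. by rewrite mulmxA mxtrace_mulC mulmxA trace_mx11. Qed.

Theorem theorem3p2
  (R : realType) (d : measure_display) (T : measurableType d) (P : probability T R)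
  (n m N : nat) (dt : R) (hdt : 0 < dt)
  (U : set 'cV[R]_m)
  (f : R -> 'cV[R]_n -> 'cV[R]_m -> 'cV[R]_n)
  (sig : R -> 'cV[R]_n -> 'M[R]_n)
  (l : R -> 'cV[R]_n -> 'cV[R]_m -> R)
  (g : 'cV[R]_n -> R)
  (mu : nat -> 'cV[R]_n -> 'cV[R]_m)
  (hl : forall t x u, 0 <= t <= N%:R * dt -> U u -> 0 <= l t x u)
  (hg : forall x, 0 <= g x)
  (hmu : forall j x, U (mu j x))
  (* measurability of the model coefficients along the policy *)
  (hfm : forall (j : nat) (k : 'I_n),
      borel_fun (fun x => f (j%:R * dt) x (mu j x) k ord0))
  (hsm : forall (j : nat) (k k' : 'I_n), borel_fun (fun x => sig (j%:R * dt) x k k'))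
  (hlm : forall j : nat, borel_fun (fun x => l (j%:R * dt) x (mu j x)))
  (hgm : borel_fun g)
  (* the Gaussian increments *)
  (W : nat -> 'I_n -> T -> R)
  (hW : forall (j : 'I_N) (k : 'I_n), std_normal P (W j k))
  (hWind : mutually_independent P (fun p : 'I_N * 'I_n => W p.1 p.2))
  (* the state process *)
  (x0 : 'cV[R]_n) (X : nat -> T -> 'cV[R]_n)
  (hX0 : X 0%N = fun _ => x0)
  (hXS : forall j : nat, (j < N)%N -> forall w,
      X j.+1 w = X j w + dt *: f (j%:R * dt) (X j w) (mu j (X j w))
                 + (Num.sqrt dt *: sig (j%:R * dt) (X j w)) *m (\col_k W j k w))
  (* value functions of the policy: V j (X j) = E[ sum_{k=j}^{N-1} L_k + g(X_N) | X_j ] *)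
  (V : nat -> 'cV[R]_n -> R)
  (hV : forall j : nat, (j <= N)%N ->
      cexp_version P (sigmaX (X j))
        (fun w => \sum_(j <= k < N) l (k%:R * dt) (X k w) (mu k (X k w)) * dt + g (X N w))
        (fun w => V j (X j w)))
  (* the fixed time index and the C^2 approximation of V_{i+1} *)
  (i : nat) (hi : (i < N)%N)
  (Vt : 'cV[R]_n -> R) (hVt : C2 Vt)
  (* Borel measurability of Vt and its derivatives (implied by C2) *)
  (hVtm : borel_fun Vt)
  (hgradm : forall k : 'I_n, borel_fun (fun x => grad Vt x k ord0))
  (hhessm : forall k k' : 'I_n, borel_fun (fun x => hess Vt x k k')) :
  let Fmu := fun w => dt *: f (i%:R * dt) (X i w) (mu i (X i w)) in
  let Sig := fun w => Num.sqrt dt *: sig (i%:R * dt) (X i w) in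
  let Wi := fun w => \col_k W i k w in
  let Lmu := fun w => l (i%:R * dt) (X i w) (mu i (X i w)) * dt in
  let Yi := fun w => V i (X i w) in
  let Xbar := fun w => X i w + Fmu w in
  let Ybar := fun w => Vt (Xbar w) in
  let Zbar := fun w => (Sig w)^T *m grad Vt (Xbar w) in
  let Mbar := fun w => (Sig w)^T *m hess Vt (Xbar w) *m Sig w in
  let Ytil := fun w => Ybar w + ((Zbar w)^T *m Wi w) ord0 ord0
                        + 2^-1 * ((Wi w)^T *m Mbar w *m Wi w) ord0 ord0 in
  let dhot := fun w => Vt (X i.+1 w) - Ytil w in
  let dV := fun w => V i.+1 (X i.+1 w) - Vt (X i.+1 w) in
  let DYhat := fun w => - Lmu w + ((Zbar w)^T *m Wi w) ord0 ord0
                        + 2^-1 * \tr (Mbar w *m (Wi w *m (Wi w)^T - 1%:M)) in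
  let Yre := fun w => Vt (X i.+1 w) - DYhat w in
  let Ynl := fun w => Ytil w - DYhat w in
  (* standing assumption: the random variables involved are square integrable *)
  (forall j : nat, (j < N)%N ->
      sq_integrable P (fun w => l (j%:R * dt) (X j w) (mu j (X j w)) * dt)) ->
  sq_integrable P (fun w => g (X N w)) ->
  sq_integrable P Yi ->
  sq_integrable P (fun w => V i.+1 (X i.+1 w)) ->
  sq_integrable P (fun w => Vt (X i.+1 w)) ->
  sq_integrable P Ybar ->
  (forall k : 'I_n, sq_integrable P (fun w => Zbar w k ord0)) ->
  (forall k k' : 'I_n, sq_integrable P (fun w => Mbar w k k')) ->
  [/\ cexp_eq P (sigmaX (X i)) (fun w => Yi w - Yre w) dV,
      cexp_eq P (sigmaX (X i)) (fun w => Yi w - Ynl w) (fun w => dV w + dhot w),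
      cvar_eq P (sigmaX (X i)) Yre dhot
    & cvar_version P (sigmaX (X i)) Ynl (fun _ => 0)].
Proof.
move=> Fmu Sig Wi Lmu Yi Xbar Ybar Zbar Mbar Ytil dhot dV DYhat Yre Ynl.
move=> sqL sqg sqYi sqV sqVt sqYbar sqZ sqM.
pose b (j : nat) (x : 'cV[R]_n) := dt *: f (j%:R * dt) x (mu j x).
pose s (j : nat) (x : 'cV[R]_n) := Num.sqrt dt *: sig (j%:R * dt) x.
pose r (j : nat) (x : 'cV[R]_n) := l (j%:R * dt) x (mu j x) * dt.
have mb j k : borel_fun (fun x => b j x k ord0).
  apply/borel_funP; rewrite (_ : (fun x => _) = fun x => dt * f (j%:R * dt) x (mu j x) k ord0).
    by apply: measurable_funM => //; apply/borel_funP; exact: hfm.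
  by apply/funext => x; rewrite mxE.
have ms j k k' : borel_fun (fun x => s j x k k').
  apply/borel_funP; rewrite (_ : (fun x => _) = fun x => Num.sqrt dt * sig (j%:R * dt) x k k').
    by apply: measurable_funM => //; apply/borel_funP; exact: hsm.
  by apply/funext => x; rewrite mxE.
have mr j : measurable_fun setT (r j : borelV R n -> R).
  by apply: measurable_funM => //; apply/borel_funP; exact: hlm.
(* The running cost is known to be nonnegative at times in [[0, N * dt]], and [k < N] places
   [k * dt] there. *)
have r0 k x : (k < N)%N -> 0 <= r k x.
  move=> kN; apply: mulr_ge0; last exact: ltW.
  apply: hl; last exact: hmu.
  by rewrite mulr_ge0 ?(ltW hdt)//= ler_pM2r// ler_nat ltnW.
pose S (j : nat) (w : T) := \sum_(j <= k < N) r k (X k w) + g (X N w).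
have mg : measurable_fun setT (g : borelV R n -> R) by exact/borel_funP.
have mXpast j : (j <= N)%N ->
    measurable_fun setT (X j : g_sigma_algebraType (past N W j) -> borelV R n).
  exact: (measurable_state mb ms hX0 hXS).
have pm j : past N W j `<=` measurable := @past_measurable _ _ _ P _ _ _ hW j.
have nm j : noise N W j `<=` measurable := @noise_measurable _ _ _ P _ _ _ hW j.
have Gpast j : (j <= N)%N -> <<s state_gens (X j) >> `<=` <<s past N W j >>.
  by move=> jN; apply: sub_state_gens; exact: mXpast.
have Gm : state_gens (X i) `<=` measurable.
  move=> A GA; apply: (smallest_sub (@sigma_algebra_measurable _ T) (pm i)).
  by apply: (Gpast _ (ltnW hi)); exact: sub_sigma_algebra.
(* [hV] only gives this for events of [X i.+1]; it is needed for those of [X i] *)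
have VE A : <<s past N W i.+1 >> A ->
    (\int[P]_(w in A) (V i.+1 (X i.+1 w))%:E =
     \int[P]_(w in A) (S i.+1 w)%:E)%E.
  exact: (@markov_value R d T P _ (borelV R n) N (past N W) (noise N W) pm nm
    (fun j => @pastS _ _ _ _ _ _ j)
    (fun j _ => @past_noise_indep _ _ _ _ _ _ _ hW hWind j)
    X (@euler_step _ _ _ _ _ _ b s) mXpast
    (measurable_euler_step mb ms) hXS r g mr mg r0 hg i.+1
    (state_gens (X i.+1)) _ hi (Gpast _ hi)
    (@measurable_state_gens _ _ _ _ _) (hV i.+1 hi)).
have mS : <<s state_gens (X i) >> `<=` measurable.
  exact: (smallest_sub (@sigma_algebra_measurable _ T) Gm).
have iL : P.-integrable setT (EFin \o Lmu).
  by apply: sq_integrable_integrable; exact: sqL.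
have iYi := sq_integrable_integrable sqYi.
have iV := sq_integrable_integrable sqV.
have iVt := sq_integrable_integrable sqVt.
have iYbar := sq_integrable_integrable sqYbar.
have iZ k := sq_integrable_integrable (sqZ k).
have iM k k' := sq_integrable_integrable (sqM k k').
have mrX k : (k < N)%N -> measurable_fun setT ((fun w => r k (X k w)) : T -> R).
  move=> kN; apply: (measurable_funG (@pm k)).
  exact: (measurableT_comp (mr k) (mXpast k (ltnW kN))).
have iS : P.-integrable setT (EFin \o S i.+1).
  apply: integrableRD; last exact: sq_integrable_integrable sqg.
  rewrite (_ : EFin \o _ = (fun w => \sum_(k <- index_iota i.+1 N)
      (if (k < N)%N then (r k (X k w))%:E else 0)))%E; last first.
    apply/funext => w /=; rewrite -sumEFin; apply: eq_big_nat => k /andP[_ ->//].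
  apply: integrable_sum => // k _; case: (ltnP k N) => kN; last exact: integrable0.
  exact: (sq_integrable_integrable (sqL k kN)).
(* Bellman's identity: over an event of [X i], [V i] integrates like [S i], which is [Lmu] plus
   [S i.+1], and [VE] handles the last term because the event also belongs to the past of [i.+1]. *)
have cYLV : centered P (state_gens (X i))
    (fun w => Yi w - Lmu w - V i.+1 (X i.+1 w)).
  split; first by apply: integrableRB => //; exact: integrableRB.
  move=> A sA; have mA := mS _ sA.
  have iSA (F : T -> R) : P.-integrable setT (EFin \o F) -> P.-integrable A (EFin \o F).
    by move=> iF; exact: (integrableS measurableT mA (@subsetT _ _) iF).
  under eq_integral do rewrite EFinB.
  rewrite integralB//; last 2 first.
  - exact: (iSA _ (integrableRB iYi iL)).
  - exact: (iSA _ iV).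
  under eq_integral do rewrite EFinB.
  rewrite integralB//; last 2 first.
  - exact: (iSA _ iYi).
  - exact: (iSA _ iL).
  rewrite VE; last by apply: pastS; exact: (Gpast _ (ltnW hi)).
  have [_ [_ ->//]] := hV i (ltnW hi).
  have -> : (\int[P]_(w in A) (S i w)%:E =
      \int[P]_(w in A) (Lmu w)%:E + \int[P]_(w in A) (S i.+1 w)%:E)%E.
    rewrite -integralD//; [|exact: iSA..].
    by apply: eq_integral => w _; rewrite -EFinD /S big_ltn// addrA.
  (* Finiteness of both integrals allows the cancellation to be carried out in the reals. *)
  have fL : (\int[P]_(w in A) (Lmu w)%:E)%E \is a fin_num.
    by have := integrable_fin_num mA (iSA _ iL).
  have fS : (\int[P]_(w in A) (S i.+1 w)%:E)%E \is a fin_num.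
    by have := integrable_fin_num mA (iSA _ iS).
  by rewrite -(fineK fL) -(fineK fS) -EFinD; congr EFin; ring.
have mshift : measurable_fun setT ((fun x => x + b i x) : borelV R n -> borelV R n).
  apply: measurable_fun_borelV => k.
  rewrite (_ : (fun x => _) = fun x : borelV R n => (x : 'cV[R]_n) k ord0 + b i x k ord0).
    by apply: measurable_funD; [exact: measurable_coord|exact/borel_funP].
  by apply/funext => x; rewrite mxE.
have mXG : measurable_fun setT
    (X i : g_sigma_algebraType (state_gens (X i)) -> borelV R n).
  exact: measurable_state_gens.
have mgrad k : measurable_fun setT
    ((fun x => grad Vt (x + b i x) k ord0) : borelV R n -> R).
  exact: (measurableT_comp ((borel_funP _).1 (hgradm k)) mshift).
have mhess k k' : measurable_fun setT
    ((fun x => hess Vt (x + b i x) k k') : borelV R n -> R).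
  exact: (measurableT_comp ((borel_funP _).1 (hhessm k k')) mshift).
have msi k k' : measurable_fun setT ((fun x => s i x k k') : borelV R n -> R).
  exact/borel_funP.
have mZX k : measurable_fun setT
    ((fun w => Zbar w k ord0) : g_sigma_algebraType (state_gens (X i)) -> R).
  apply: (measurableT_comp _ mXG (f := fun x : borelV R n =>
    ((s i x)^T *m grad Vt (x + b i x)) k ord0)).
  rewrite (_ : (fun x => _) = fun x : borelV R n =>
      \sum_j s i x j k * grad Vt (x + b i x) j ord0).
    by apply: measurable_sum => j; exact: measurable_funM.
  by apply/funext => x; rewrite mxE; apply: eq_bigr => j _; rewrite mxE.
have mMX k k' : measurable_fun setT
    ((fun w => Mbar w k k') : g_sigma_algebraType (state_gens (X i)) -> R).
  apply: (measurableT_comp _ mXG (f := fun x : borelV R n =>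
    ((s i x)^T *m hess Vt (x + b i x) *m s i x) k k')).
  rewrite (_ : (fun x => _) = fun x : borelV R n =>
      \sum_j (\sum_j' s i x j' k * hess Vt (x + b i x) j' j) * s i x j k').
    apply: measurable_sum => j; apply: measurable_funM => //.
    by apply: measurable_sum => j'; exact: measurable_funM.
  apply/funext => x; rewrite mxE; apply: eq_bigr => j _; congr (_ * _).
  by rewrite mxE; apply: eq_bigr => j' _; rewrite mxE.
pose D w := ((Zbar w)^T *m Wi w) ord0 ord0
            + 2^-1 * \tr (Mbar w *m (Wi w *m (Wi w)^T - 1%:M)).
have cD : centered P (state_gens (X i)) D.
  (* Independence of the noise is available for the whole past; the result is then restricted to
     events of [X i]. *)
  apply: (sub_centered (Gpast _ (ltnW hi))).
  apply: (centeredD (pm i)); first (apply: (centered_linear hW hWind hi) => // k;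
    exact: (measurable_fun_sub_gens (Gpast _ (ltnW hi)))).
  apply: (centeredZ (pm i)); apply: (centered_quadratic hW hWind hi) => // k k'.
  exact: (measurable_fun_sub_gens (Gpast _ (ltnW hi))).
pose C w := Ybar w + Lmu w + 2^-1 * \tr (Mbar w).
have iC : P.-integrable setT (EFin \o C).
  apply: integrableRD; first exact: integrableRD.
  by apply: integrableRZ; apply: integrableR_sum => k; exact: iM.
have mC : measurable_fun setT (C : g_sigma_algebraType (state_gens (X i)) -> R).
  apply: measurable_funD.
    apply: measurable_funD; last exact: (measurableT_comp (mr i) mXG).
    have mVt : measurable_fun setT (Vt : borelV R n -> R) by exact/borel_funP.
    exact: (measurableT_comp (measurableT_comp mVt mshift) mXG).
  by apply: measurable_funM => //; apply: measurable_sum => k; exact: mMX.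
have DYE w : DYhat w = - Lmu w + D w by rewrite /DYhat /D addrA.
have YtilE w : Ytil w = C w + DYhat w.
  (* Subtracting the identity under the trace removes [tr M / 2], which [C] restores; the [Lmu] in
     [C] cancels the one in [DYhat]. *)
  rewrite /Ytil /C DYE /D mulmxBr mulmx1 raddfB /=.
  rewrite quadratic_trace.
  by ring.
have iD : P.-integrable setT (EFin \o D) by have [] := cD.
have iDY : P.-integrable setT (EFin \o DYhat).
  rewrite (_ : DYhat = fun w => D w - Lmu w); first exact: integrableRB.
  by apply/funext => w; rewrite DYE addrC.
have iYtil : P.-integrable setT (EFin \o Ytil).
  by rewrite (_ : Ytil = fun w => C w + DYhat w); [exact: integrableRD|apply/funext].
have idhot : P.-integrable setT (EFin \o dhot) by exact: integrableRB.
have idV : P.-integrable setT (EFin \o dV) by exact: integrableRB.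
have iYre : P.-integrable setT (EFin \o Yre) by exact: integrableRB.
have YnlE : Ynl = C by apply/funext => w; rewrite /Ynl YtilE addrK.
split.
- apply: cexp_eq_centered => //.
  (* [Vt] cancels here, and [Ytil] cancels as well in the second bias, so both discrepancies are the
     same sum of two centered variables. *)
  rewrite (_ : (fun w => _) = fun w => (Yi w - Lmu w - V i.+1 (X i.+1 w)) + D w).
    exact: (centeredD Gm).
  by apply/funext => w; rewrite /Yre /dV DYE; ring.
- apply: cexp_eq_centered => //; first exact: integrableRD.
  rewrite (_ : (fun w => _) = fun w => (Yi w - Lmu w - V i.+1 (X i.+1 w)) + D w).
    exact: (centeredD Gm).
  by apply/funext => w; rewrite /Ynl /dV /dhot DYE; ring.
- rewrite (_ : dhot = fun w => Yre w - C w); first exact: (cvar_eqB Gm).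
  by apply/funext => w; rewrite /dhot /Yre YtilE; ring.
- by rewrite YnlE; exact: cvar_version_self.
Qed.
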